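(* Let $R$ be a left perfect ring and let $M$ be an eventually periodic $R$-module of finite Gorenstein projective dimension $r$. Then $$r \,\leq\, \operatorname{per.dim}_R M \,\leq\, r+1.$$ Moreover, there exists an isomorphism $$\Omega_{R}^{r+p}(M) \cong \Omega_{R}^{r}(M)$$ in the stable category $R\text{-}\underline{\mathrm{Mod}}$, where $p$ is the period of the first periodic syzygy of $M$.
   Context: All rings are associative and unital; modules are left modules (not necessarily finitely generated). Over a left perfect ring $R$ every module has a projective cover. The syzygy $\Omega_R(M)$ is the kernel of a projective cover $P\to M$; set $\Omega_R^0(M)=M$ and $\Omega_R^n(M)=\Omega_R(\Omega_R^{n-1}(M))$ for $n\ge 1$. An $R$-module $M$ is periodic if $\Omega_R^p(M)\cong M$ as $R$-modules for some integer $p>0$; the smallest such $p$ is the period of $M$. $M$ is eventually periodic if $\Omega_R^n(M)$ is periodic for some $n\ge 0$. The periodic dimension is $\operatorname{per.dim}_R M=\inf\{n\ge 0\mid \Omega_R^n(M)\text{ is periodic}\}$. The first periodic syzygy of an eventually periodic module $M$ is $\Omega_R^{n}(M)$ with $n=\operatorname{per.dim}_R M$. An acyclic complex $T_\bullet$ of projective $R$-modules is totally acyclic if $\operatorname{Hom}_R(T_\bullet,Q)$ is acyclic for every projective $R$-module $Q$. An $R$-module is Gorenstein projective if it is isomorphic to the cokernel of $T_1\to T_0$ for some totally acyclic complex $T_\bullet$. The Gorenstein projective dimension $\operatorname{Gpd}_R M$ is the infimum of the lengths $n$ of exact sequences $0\to G_n\to\cdots\to G_0\to M\to 0$ with all $G_i$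 Gorenstein projective. The stable category $R\text{-}\underline{\mathrm{Mod}}$ has all $R$-modules as objects, and morphisms from $M$ to $N$ are $\operatorname{Hom}_R(M,N)$ modulo the subgroup of morphisms factoring through a projective module. *)

(* Defs.v *)
From HB Require Import structures.
From mathcomp Require Import all_boot all_order all_algebra.
From mathcomp Require Import boolp.

Set Implicit Arguments.
Unset Strict Implicit.
Unset Printing Implicit Defensive.

Import GRing.Theory.
Local Open Scope ring_scope.

(* Infimum of a set of natural numbers in nat + {+oo}, with None as +oo. *)
Definition nat_inf (P : nat -> Prop) : option nat :=
  if pselect (exists n, `[< P n >]) is left exP then Some (ex_minn exP)
  else None.

Section Modules.

Variable R : pzRingType.

Implicit Types M N P Q : lmodType R.

Definition surj (A B : Type) (f : A -> B) : Prop := forall y, exists x, f x = y.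

Definition iso M N : Prop := exists f : {linear M -> N}, bijective f.

(* Exactness at the middle term of L -> M -> N. *)
Definition is_exact (L M N : lmodType R)
    (f : {linear L -> M}) (g : {linear M -> N}) : Prop :=
  forall y, g y = 0 <-> exists x, f x = y.

Definition projective P : Prop :=
  forall (M N : lmodType R) (g : {linear M -> N}) (f : {linear P -> N}),
    surj g -> exists h : {linear P -> M}, g \o h =1 f.

Section Kernel.

Variables (M N : lmodType R) (f : {linear M -> N}).

Definition kernel_pred : {pred M} := [pred x | f x == 0].

Lemma kernel_pred_submod_closed : submod_closed kernel_pred.
Proof.
split=> [|a x y]; rewrite !inE ?linear0 // => /eqP fx0 /eqP fy0.
by rewrite linearP fx0 fy0 scaler0 addr0.
Qed.

HB.instance Definition _ :=
  GRing.isSubmodClosed.Build R M kernel_pred kernel_pred_submod_closed.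

Definition kernel : Type := {x : M | x \in kernel_pred}.

HB.instance Definition _ := SubChoice.on kernel.
HB.instance Definition _ :=
  [SubChoice_isSubLmodule of kernel by <:].

End Kernel.

(* P is projective and the kernel of the epimorphism f is superfluous in P. *)
Definition projective_cover P M (f : {linear P -> M}) : Prop :=
  [/\ projective P, surj f &
      forall S : {pred P}, submod_closed S ->
        (forall x, exists s k, [/\ s \in S, f k = 0 & x = s + k]) ->
        forall x, x \in S].

(* Bass's definition of a left perfect ring. *)
Definition left_perfect : Prop :=
  forall M, exists P, exists f : {linear P -> M}, projective_cover f.

Section Syzygies.

Variable perfectR : left_perfect.

Definition cover_obj M : lmodType R := sval (cid (perfectR M)).

Definition cover_map M : {linear cover_obj M -> M} :=
  sval (cid (svalP (cid (perfectR M)))).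

Definition Omega M : lmodType R := kernel (cover_map M).

Fixpoint syzygy (n : nat) M : lmodType R :=
  if n is n'.+1 then Omega (syzygy n' M) else M.

Definition is_period_of M (p : nat) : Prop := (0 < p)%N /\ iso (syzygy p M) M.

Definition periodic M : Prop := exists p, is_period_of M p.

Definition period M : option nat := nat_inf (is_period_of M).

Definition eventually_periodic M : Prop := exists n, periodic (syzygy n M).

Definition per_dim M : option nat := nat_inf (fun n => periodic (syzygy n M)).

End Syzygies.

(* T_i is T i and the differential T_(i+1) -> T_i is d i. The last condition  *)
(* is the exactness of Hom(T_i, Q) -> Hom(T_(i+1), Q) -> Hom(T_(i+2), Q).     *)
Definition totally_acyclic (T : int -> lmodType R)
    (d : forall i, {linear T (i + 1) -> T i}) : Prop :=
  [/\ forall i, projective (T i),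
      forall i, is_exact (d (i + 1)) (d i) &
      forall Q, projective Q -> forall i (u : {linear T (i + 1) -> Q}),
        (forall x, u (d (i + 1) x) = 0) <->
        (exists v : {linear T i -> Q}, u =1 v \o d i)].

(* A module isomorphic to the cokernel of d 0 : T_1 -> T_0 is one with an     *)
(* exact sequence T_1 -> T_0 -> M -> 0.                                       *)
Definition gorenstein_projective M : Prop :=
  exists (T : int -> lmodType R) (d : forall i, {linear T (i + 1) -> T i}),
    totally_acyclic d /\
    exists c : {linear T 0 -> M}, surj c /\ is_exact (d 0) c.

(* An exact sequence 0 -> G_n -> ... -> G_0 -> M -> 0, padded by zero modules *)
(* in degrees above n.                                                        *)
Definition has_gproj_resolution M (n : nat) : Prop :=
  exists (G : nat -> lmodType R) (d : forall i, {linear G i.+1 -> G i})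
         (e : {linear G 0%N -> M}),
    [/\ forall i, (i <= n)%N -> gorenstein_projective (G i),
        forall i, (n < i)%N -> forall x : G i, x = 0,
        surj e, is_exact (d 0%N) e &
        forall i, is_exact (d i.+1) (d i)].

Definition Gpd M : option nat := nat_inf (has_gproj_resolution M).

Definition factors_through_projective M N (f : {linear M -> N}) : Prop :=
  exists P, projective P /\
    exists (a : {linear M -> P}) (b : {linear P -> N}), f =1 b \o a.

(* Equality of the classes of f and g in the stable category. *)
Definition stable_eq M N (f g : {linear M -> N}) : Prop :=
  factors_through_projective (f \- g).

(* Isomorphism in the stable category. *)
Definition stable_iso M N : Prop :=
  exists (f : {linear M -> N}) (g : {linear N -> M}),
    stable_eq (g \o f) idfun /\ stable_eq (f \o g) idfun.

End Modules.

(* Main.v *)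
Require Import Defs.
From HB Require Import structures.
From mathcomp Require Import all_boot all_order all_algebra.
From mathcomp Require Import boolp.

(** Write Ext^(n+1)(Y, Q) = 0 as the statement that every map from the left
    term of a short exact sequence ending in Omega^n Y extends to its middle
    term ([ext1_zero], [ext_zero]).

    Two facts relate syzygies to the stable category.  If h' is induced on the
    syzygy of X by an endomorphism h of X that is the identity modulo maps
    through projectives, then h' differs from the identity only by a map that
    extends to the projective P over X ([syzygy_stable_id]).  Over a projective
    cover this forces h' to be bijective, because the cover is superfluous, so
    a stable isomorphism X ~ Y becomes an honest isomorphism
    Omega X ~ Omega Y ([stable_iso_Omega]).  Conversely a stable isomorphism
    Omega X ~ Omega Y comes from a stable isomorphism X ~ Y as soon as
    Ext^1(X, Q) = Ext^1(Y, Q) = 0 for projective Q ([stable_iso_of_Omega]).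

    Let M have Gorenstein projective dimension r.  Gorenstein projective modules
    have no higher Ext into projectives ([totally_acyclic_ext_zero]), and
    dimension shifting along a resolution of length r, by the horseshoe lemma,
    gives Ext^(m+1)(M, Q) = 0 for m >= r ([gproj_resolution_ext_zero]).

    Let n be the periodic dimension of M and p the period of X = Omega^n M.
    - r <= n: by periodicity X is isomorphic to syzygies of M of arbitrarily
      high order, hence has no higher Ext into projectives at all.  Splicing its
      periodic projective resolution in both directions gives an acyclic complex
      that the Ext vanishing makes totally acyclic, so X is Gorenstein
      projective ([periodic_gorenstein_projective]) and the projective covers
      resolve M in length n.
    - Omega^(r+p) M ~ Omega^r M stably: start from Omega^(n+p) M ~ Omega^n M and
      remove one Omega at a time; all the modules met on the way are syzygies of
      order at least r, where Ext^1 into projectives vanishes.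
    - n <= r + 1: applying Omega to that stable isomorphism gives an isomorphism
      Omega^(r+1+p) M ~ Omega^(r+1) M, so Omega^(r+1) M is periodic. *)

Set Implicit Arguments.
Unset Strict Implicit.
Unset Printing Implicit Defensive.

Import GRing.Theory.
Local Open Scope ring_scope.

(** * Short exact sequences and pullbacks *)

Section ExactSequences.

Variable R : pzRingType.

Implicit Types A B E L M N P Q W X Y Z : lmodType R.

Definition linear_map M N (f : M -> N) (lf : linear f) : {linear M -> N} :=
  HB.pack f (GRing.isLinear.Build R M N *:%R f lf).

Definition kernel_incl M N (f : {linear M -> N}) : {linear kernel f -> M} := val.

Fact pair_0r_linear M N : linear (fun x : M => (x, 0) : (M * N)%type).
Proof. by move=> a x y; congr pair; rewrite /= scaler0 addr0. Qed.

Fact pair_0l_linear M N : linear (fun y : N => (0, y) : (M * N)%type).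
Proof. by move=> a x y; congr pair; rewrite /= scaler0 addr0. Qed.

Definition inj_fst M N : {linear M -> (M * N)%type} :=
  linear_map (@pair_0r_linear M N).

Definition inj_snd M N : {linear N -> (M * N)%type} :=
  linear_map (@pair_0l_linear M N).

Definition copair M N L (f : {linear M -> L}) (g : {linear N -> L}) :
    {linear (M * N)%type -> L} :=
  (f \o fst) \+ (g \o snd).

Definition short_exact A B Y (j : {linear A -> B}) (q : {linear B -> Y}) : Prop :=
  [/\ injective j, is_exact j q & surj q].

Definition extends_along A B (j : {linear A -> B}) Q : Prop :=
  forall u : {linear A -> Q}, exists v : {linear B -> Q}, forall x, v (j x) = u x.

Lemma injective_ker0 A B (j : {linear A -> B}) :
  (forall x, j x = 0 -> x = 0) -> injective j.
Proof.
move=> j0 x y jxy; apply/eqP; rewrite -subr_eq0; apply/eqP/j0.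
by rewrite linearB jxy subrr.
Qed.

Lemma injective_surj_bijective (A B : Type) (f : A -> B) :
  injective f -> surj f -> bijective f.
Proof.
move=> injf surjf; exists (fun y => sval (cid (surjf y))) => [x|y].
  by apply: injf; case: cid.
by case: cid.
Qed.

Lemma factor_surj M N Q (s : {linear M -> N}) (u : {linear M -> Q}) :
  surj s -> (forall x, s x = 0 -> u x = 0) ->
  exists w : {linear N -> Q}, forall x, w (s x) = u x.
Proof.
move=> surjs ker_su.
pose t y := sval (cid (surjs y)).
have tK y : s (t y) = y by rewrite /t; case: cid.
have utE x y : s x = y -> u (t y) = u x.
  move=> sxy; apply/eqP; rewrite -subr_eq0 -linearB; apply/eqP/ker_su.
  by rewrite linearB tK sxy subrr.
have lin_ut : linear (fun y => u (t y)).
  move=> a x y; rewrite -linearP; apply: utE.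
  by rewrite linearP !tK.
by exists (linear_map lin_ut) => x; apply: utE.
Qed.

Lemma factor_inj A B M (j : {linear A -> B}) (u : {linear M -> B}) :
  injective j -> (forall x, exists a, j a = u x) ->
  exists w : {linear M -> A}, forall x, j (w x) = u x.
Proof.
move=> injj im_u.
pose w x := sval (cid (im_u x)).
have jw x : j (w x) = u x by rewrite /w; case: cid.
have lin_w : linear w.
  by move=> a x y; apply: injj; rewrite linearP !jw linearP.
by exists (linear_map lin_w) => x; apply: jw.
Qed.

Lemma kernel_short_exact M N (q : {linear M -> N}) :
  surj q -> short_exact (kernel_incl q) q.
Proof.
move=> surjq; split=> //; first exact: val_inj.
move=> y; split=> [qy0|[x <-]]; last first.
  by have := valP x; rewrite inE => /eqP.
have ky : y \in kernel_pred q by rewrite inE qy0.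
by exists (exist _ y ky).
Qed.

(** The middle condition says that the two projections are jointly injective;
    together with the last one it is the universal property of the pullback,
    see [pullback_lift]. *)
Definition is_pullback E Y Z W (q : {linear E -> Y}) (g : {linear Z -> Y})
    (p : {linear W -> E}) (r : {linear W -> Z}) : Prop :=
  [/\ forall w, q (p w) = g (r w),
      forall w, p w = 0 -> r w = 0 -> w = 0 &
      forall e z, q e = g z -> exists w, p w = e /\ r w = z].

Lemma pullback_lift E Y Z W M (q : {linear E -> Y}) (g : {linear Z -> Y})
    (p : {linear W -> E}) (r : {linear W -> Z})
    (u : {linear M -> E}) (v : {linear M -> Z}) :
  is_pullback q g p r -> (forall x, q (u x) = g (v x)) ->
  exists w : {linear M -> W}, forall x, p (w x) = u x /\ r (w x) = v x.
Proof.
case=> _ pr0 pbE quv.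
have lin_pr : linear (fun w => (p w, r w)) by move=> a x y; rewrite !linearP.
have lin_uv : linear (fun x => (u x, v x)) by move=> a x y; rewrite !linearP.
have inj_pr : injective (linear_map lin_pr).
  by apply: injective_ker0 => x [pw0 rw0]; apply: pr0.
have im_uv x : exists w, linear_map lin_pr w = linear_map lin_uv x.
  by have [w [pw rw]] := pbE _ _ (quv x); exists w; congr pair.
by have [w wE] := factor_inj inj_pr im_uv; exists w => x; have [] := wE x.
Qed.

(** Pulling an extension of Y back along g : Z -> Y gives an extension of Z with
    the same left term, so maps out of that left term can be extended over Z. *)
Lemma pullback_short_exact A E Y Z (j : {linear A -> E}) (q : {linear E -> Y})
    (g : {linear Z -> Y}) :
  short_exact j q ->
  exists (W : lmodType R) (i : {linear A -> W})
         (r : {linear W -> Z}) (p : {linear W -> E}),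
    [/\ short_exact i r, is_pullback q g p r & forall a, p (i a) = j a].
Proof.
case=> injj exq surjq.
have lin_h : linear (fun z : E * Z => q z.1 - g z.2).
  by move=> a x y /=; rewrite !linearP /= scalerDr addrACA.
pose h : {linear (E * Z)%type -> Y} := linear_map lin_h.
pose p : {linear kernel h -> E} := (fst \o kernel_incl h : {linear _ -> _}).
pose r : {linear kernel h -> Z} := (snd \o kernel_incl h : {linear _ -> _}).
have pb : is_pullback q g p r.
  split=> [w|w pw0 rw0|e z qe].
  - by have := valP w; rewrite inE /= subr_eq0 => /eqP.
  - by apply: val_inj; rewrite [LHS]surjective_pairing; congr pair.
  - have kz : (e, z) \in kernel_pred h by rewrite inE /= qe subrr.
    by exists (exist _ (e, z) kz).
have qj a : q (j a) = g ((\0 : {linear A -> Z}) a).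
  by rewrite linear0; apply/exq; exists a.
clearbody p r.
have [i iE] := pullback_lift pb qj.
have [qp pr0 pbE] := pb.
exists (kernel h), i, r, p; split=> // [|a]; last by have [] := iE a.
split=> [a b iab|w|z].
- by apply: injj; have [<- _] := iE a; have [<- _] := iE b; rewrite iab.
- split=> [rw0|[a <-]]; last by have [] := iE a.
  have /exq [a ja] : q (p w) = 0 by rewrite qp rw0 linear0.
  exists a; apply/eqP; rewrite -subr_eq0; apply/eqP; have [pia ria] := iE a.
  by apply: pr0; rewrite linearB ?pia ?ria ?ja ?rw0 ?subrr.
- have [e qe] := surjq (g z).
  by have [w [_ rw]] := pbE _ _ qe; exists w.
Qed.

End ExactSequences.

(** * Endomorphisms that are stably the identity *)

Section StableEndomorphisms.

Variable R : pzRingType.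

Implicit Types A B E L M N P Q W X Y Z : lmodType R.

Lemma stable_eq_id X (h : {linear X -> X}) :
  stable_eq h idfun <->
  exists P, projective P /\
    exists (a : {linear X -> P}) (b : {linear P -> X}),
      forall x, h x = x + b (a x).
Proof.
split=> -[P [projP [a [b hE]]]]; exists P; split=> //; exists a, b => x.
  by rewrite -[b (a x)]hE /= addrC subrK.
by rewrite /= hE addrC addKr.
Qed.

(** If h = 1 + b a through a projective P', lift b to b' : P' -> P.  Then
    H - 1 - b' a q has values in ker q, and the term b' a q is zero on ker q:
    H - 1 factors there through a map phi defined on all of P. *)
Lemma syzygy_stable_id L P X (i : {linear L -> P}) (q : {linear P -> X})
    (h : {linear X -> X}) (H : {linear P -> P}) (h' : {linear L -> L}) :
  short_exact i q ->
  (forall x, q (H x) = h (q x)) -> (forall x, i (h' x) = H (i x)) ->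
  stable_eq h idfun ->
  exists phi : {linear P -> L}, forall x, h' x = x + phi (i x).
Proof.
case=> inji exq surjq qH iH /stable_eq_id [P' [projP' [a [b hE]]]].
have [b' b'E] := projP' _ _ q b surjq.
have qb' x : q (b' x) = b x by exact: b'E.
have qi x : q (i x) = 0 by apply/exq; exists x.
pose u : {linear P -> P} :=
  (H \- (idfun \+ (b' \o (a \o q))) : {linear _ -> _}).
have uE x : u x = H x - (x + b' (a (q x))) by [].
have im_u x : exists y, i y = u x.
  by apply/exq; rewrite uE !linearB linearD qb' qH hE subrr.
have [phi phiE] := factor_inj inji im_u.
exists phi => x; apply: inji.
by rewrite linearD phiE uE qi !linear0 addr0 iH addrC subrK.
Qed.

(** The image of H together with the superfluous submodule ker q spans P. *)
Lemma projective_cover_surj P X (q : {linear P -> X}) (H : {linear P -> P}) :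
  projective_cover q -> (forall x, q (H x) = q x) -> surj H.
Proof.
case=> _ _ small qH.
pose S : {pred P} := [pred y | `[< exists x, H x = y >]].
have S_closed : submod_closed S.
  split=> [|c y z]; rewrite !inE.
    by apply/asboolP; exists 0; rewrite linear0.
  move=> /asboolP[y' <-] /asboolP[z' <-]; apply/asboolP.
  by exists (c *: y' + z'); rewrite linearP.
move=> y; apply/asboolP; have := small S S_closed _ y; rewrite inE; apply.
move=> x; exists (H x), (x - H x); rewrite inE; split.
- by apply/asboolP; exists x.
- by rewrite linearB qH subrr.
- by rewrite addrC subrK.
Qed.

(** H is onto, hence has a section s because P is projective; s also lies over the
    identity of X, so it is onto as well and H is bijective. *)
Lemma projective_cover_bij P X (q : {linear P -> X}) (H : {linear P -> P}) :
  projective_cover q -> (forall x, q (H x) = q x) -> bijective H.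
Proof.
move=> coverq qH; have surjH := projective_cover_surj coverq qH.
have [projP _ _] := coverq.
have [s sE] := projP _ _ H idfun surjH.
have sK x : H (s x) = x by exact: sE.
have qs x : q (s x) = q x by rewrite -qH sK.
have surjs := projective_cover_surj coverq qs.
apply: injective_surj_bijective => //; apply: injective_ker0 => x.
by have [y <-] := surjs x; rewrite sK => ->; rewrite linear0.
Qed.

(** With phi as in [syzygy_stable_id], 1 + i phi lies over the identity of X, so
    it is an automorphism of the cover P; it preserves L in both directions and
    induces h' there. *)
Lemma syzygy_stable_id_bij L P X (i : {linear L -> P}) (q : {linear P -> X})
    (h : {linear X -> X}) (H : {linear P -> P}) (h' : {linear L -> L}) :
  short_exact i q -> projective_cover q ->
  (forall x, q (H x) = h (q x)) -> (forall x, i (h' x) = H (i x)) ->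
  stable_eq h idfun -> bijective h'.
Proof.
move=> seq_iq coverq qH iH h1.
have [phi h'E] := syzygy_stable_id seq_iq qH iH h1.
have [inji exq surjq] := seq_iq.
have qi x : q (i x) = 0 by apply/exq; exists x.
pose U : {linear P -> P} := (idfun \+ (i \o phi) : {linear _ -> _}).
have UE x : U x = x + i (phi x) by [].
have qU x : q (U x) = q x by rewrite UE linearD qi addr0.
have iU x : i (h' x) = U (i x) by rewrite UE h'E linearD.
have [V UK VK] := projective_cover_bij coverq qU.
apply: injective_surj_bijective => [x y h'xy|y].
  by apply/inji/(can_inj UK); rewrite -!iU h'xy.
have /exq [x xE] : q (V (i y)) = 0 by rewrite -qU VK qi.
by exists x; apply: inji; rewrite iU xE VK.
Qed.

(** The reverse of [syzygy_stable_id]: if h' = 1 + b a and a extends to a' on P,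
    then H - 1 - i b a' is zero on L, so it descends to s : X -> P with
    h = 1 + q s. *)
Lemma stable_id_of_syzygy L P X (i : {linear L -> P}) (q : {linear P -> X})
    (h : {linear X -> X}) (H : {linear P -> P}) (h' : {linear L -> L}) :
  short_exact i q -> projective P ->
  (forall Q, projective Q -> extends_along i Q) ->
  (forall x, q (H x) = h (q x)) -> (forall x, i (h' x) = H (i x)) ->
  stable_eq h' idfun -> stable_eq h idfun.
Proof.
case=> inji exq surjq projP ext_i qH iH /stable_eq_id[P' [projP' [a [b h'E]]]].
have qi x : q (i x) = 0 by apply/exq; exists x.
have [a' a'E] := ext_i _ projP' a.
pose u : {linear P -> P} :=
  (H \- (idfun \+ (i \o (b \o a'))) : {linear _ -> _}).
have uE x : u x = H x - (x + i (b (a' x))) by [].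
have ker_u x : q x = 0 -> u x = 0.
  by case/exq=> y <-; rewrite uE a'E -iH h'E linearD subrr.
have [s sE] := factor_surj surjq ker_u.
apply/stable_eq_id; exists P; split=> //; exists s, q => y.
have [x <-] := surjq y.
by rewrite sE uE linearB linearD qi addr0 qH addrC subrK.
Qed.

End StableEndomorphisms.

(** * Syzygies and the stable category *)

Section StableCategory.

Variable R : pzRingType.

Implicit Types A B E L M N P Q W X Y Z : lmodType R.

Lemma syzygy_map L P X L' P' Y (i : {linear L -> P}) (q : {linear P -> X})
    (i' : {linear L' -> P'}) (q' : {linear P' -> Y}) (f : {linear X -> Y}) :
  short_exact i q -> short_exact i' q' -> projective P ->
  exists (F : {linear P -> P'}) (f' : {linear L -> L'}),
    (forall x, q' (F x) = f (q x)) /\ (forall x, i' (f' x) = F (i x)).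
Proof.
move=> [_ exq _] [inji' exq' surjq'] projP.
have [F FE] := projP _ _ q' (f \o q : {linear _ -> _}) surjq'.
have q'F x : q' (F x) = f (q x) by exact: FE.
have im_Fi x : exists y, i' y = (F \o i : {linear _ -> _}) x.
  apply/exq'; rewrite /= q'F.
  by have /exq -> : exists y, i y = i x; [exists x | rewrite linear0].
by have [f' f'E] := factor_inj inji' im_Fi; exists F, f'.
Qed.

(** The descent from syzygies to modules, dual to [syzygy_map]: here the
    extension property of i replaces the projectivity of P. *)
Lemma cosyzygy_map L P X L' P' Y (i : {linear L -> P}) (q : {linear P -> X})
    (i' : {linear L' -> P'}) (q' : {linear P' -> Y}) (f' : {linear L -> L'}) :
  short_exact i q -> short_exact i' q' -> extends_along i P' ->
  exists (F : {linear P -> P'}) (f : {linear X -> Y}),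
    (forall x, q' (F x) = f (q x)) /\ (forall x, i' (f' x) = F (i x)).
Proof.
move=> [_ exq surjq] [_ exq' _] ext_i.
have [F FE] := ext_i (i' \o f' : {linear _ -> _}).
have Fi x : F (i x) = i' (f' x) by exact: FE.
have ker_q'F x : q x = 0 -> (q' \o F : {linear _ -> _}) x = 0.
  by case/exq=> y <- /=; rewrite Fi; apply/exq'; exists (f' y).
by have [f fE] := factor_surj surjq ker_q'F; exists F, f; split=> x.
Qed.

(** A one-sided stable isomorphism.  It is all that transports Ext vanishing, and
    it holds between any two syzygies of the same module. *)
Definition stable_retract X Y : Prop :=
  exists (f : {linear X -> Y}) (g : {linear Y -> X}), stable_eq (g \o f) idfun.

Lemma syzygy_stable_retract L P X L' P' Y
    (i : {linear L -> P}) (q : {linear P -> X})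
    (i' : {linear L' -> P'}) (q' : {linear P' -> Y}) :
  short_exact i q -> projective P -> short_exact i' q' -> projective P' ->
  stable_retract X Y -> stable_retract L L'.
Proof.
move=> seq_iq projP seq_iq' projP' [f [g gf1]].
have [F [f' [q'F i'f']]] := syzygy_map f seq_iq seq_iq' projP.
have [G [g' [qG ig']]] := syzygy_map g seq_iq' seq_iq projP'.
have qGF x : q ((G \o F) x) = (g \o f) (q x) by rewrite /= qG q'F.
have igf x : i ((g' \o f') x) = (G \o F) (i x) by rewrite /= ig' i'f'.
have [phi phiE] := syzygy_stable_id seq_iq qGF igf gf1.
by exists f', g'; apply/stable_eq_id; exists P; split=> //; exists i, phi.
Qed.

Variable perfectR : left_perfect R.

Local Notation Omega := (Omega perfectR).
Local Notation syzygy := (syzygy perfectR).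

Definition Omega_incl X : {linear Omega X -> cover_obj perfectR X} :=
  kernel_incl (cover_map perfectR X).

Lemma cover_mapP X : projective_cover (cover_map perfectR X).
Proof. exact: svalP (cid (svalP (cid (perfectR X)))). Qed.

Lemma cover_projective X : projective (cover_obj perfectR X).
Proof. by have [] := cover_mapP X. Qed.

Lemma Omega_short_exact X : short_exact (Omega_incl X) (cover_map perfectR X).
Proof. by apply: kernel_short_exact; have [] := cover_mapP X. Qed.

Lemma syzygyD m n X : syzygy (m + n) X = syzygy m (syzygy n X).
Proof. by elim: m => //= m ->. Qed.

Lemma stable_eq1 X (h : {linear X -> X}) : h =1 id -> stable_eq h idfun.
Proof.
move=> h1; apply/stable_eq_id; exists (cover_obj perfectR X).
split; first exact: cover_projective.
by exists \0, \0 => x; rewrite h1 linear0 addr0.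
Qed.

Lemma iso_refl X : iso X X.
Proof. by exists idfun; exists id. Qed.

Lemma iso_sym X Y : iso X Y -> iso Y X.
Proof.
move=> [f [g fK gK]]; have lin_g : linear g.
  by move=> a x y; apply: (can_inj fK); rewrite gK linearP !gK.
by exists (linear_map lin_g); exists f.
Qed.

Lemma iso_trans X Y Z : iso X Y -> iso Y Z -> iso X Z.
Proof.
by move=> [f bijf] [g bijg]; exists (g \o f : {linear _ -> _}); apply: bij_comp.
Qed.

Lemma iso_stable_iso X Y : iso X Y -> stable_iso X Y.
Proof.
move=> [f [g fK gK]]; have lin_g : linear g.
  by move=> a x y; apply: (can_inj fK); rewrite gK linearP !gK.
by exists f, (linear_map lin_g); split; apply: stable_eq1.
Qed.

Lemma stable_iso_retract X Y : stable_iso X Y -> stable_retract X Y.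
Proof. by move=> [f [g [gf1 _]]]; exists f, g. Qed.

Lemma stable_iso_Omega X Y : stable_iso X Y -> iso (Omega X) (Omega Y).
Proof.
move=> [f [g [gf1 fg1]]].
have [seqX seqY] := (Omega_short_exact X, Omega_short_exact Y).
have [F [f' [qF if']]] := syzygy_map f seqX seqY (@cover_projective X).
have [G [g' [qG ig']]] := syzygy_map g seqY seqX (@cover_projective Y).
have /bij_inj inj_gf : bijective (g' \o f').
  apply: (@syzygy_stable_id_bij _ _ _ _ _ _ (g \o f) (G \o F) (g' \o f')
            seqX (cover_mapP X) _ _ gf1) => x.
    exact: etrans (qG _) (congr1 g (qF x)).
  exact: etrans (ig' _) (congr1 G (if' x)).
have [k _ fgK] : bijective (f' \o g').
  apply: (@syzygy_stable_id_bij _ _ _ _ _ _ (f \o g) (F \o G) (f' \o g')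
            seqY (cover_mapP Y) _ _ fg1) => x.
    exact: etrans (qF _) (congr1 f (qG x)).
  exact: etrans (if' _) (congr1 F (ig' x)).
exists f'; apply: injective_surj_bijective => [x y f'xy|y].
  by apply: inj_gf; rewrite /= f'xy.
by exists (g' (k y)); exact: fgK.
Qed.

Lemma iso_syzygy n X Y : iso X Y -> iso (syzygy n X) (syzygy n Y).
Proof.
by elim: n => //= n IHn /IHn isoXY; apply/stable_iso_Omega/iso_stable_iso.
Qed.

Lemma stable_retract_syzygy n X Y :
  stable_retract X Y -> stable_retract (syzygy n X) (syzygy n Y).
Proof.
elim: n => //= n IHn /IHn; apply: syzygy_stable_retract;
  by [apply: Omega_short_exact | apply: cover_projective].
Qed.

Lemma stable_iso_of_Omega X Y :
  (forall Q, projective Q -> extends_along (Omega_incl X) Q) ->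
  (forall Q, projective Q -> extends_along (Omega_incl Y) Q) ->
  stable_iso (Omega X) (Omega Y) -> stable_iso X Y.
Proof.
move=> extX extY [f' [g' [gf1 fg1]]].
have [seqX seqY] := (Omega_short_exact X, Omega_short_exact Y).
have [projX projY] := (@cover_projective X, @cover_projective Y).
have [F [f [qF if']]] := cosyzygy_map f' seqX seqY (extX _ projY).
have [G [g [qG ig']]] := cosyzygy_map g' seqY seqX (extY _ projX).
exists f, g; split.
  apply: (@stable_id_of_syzygy _ _ _ _ _ _ (g \o f) (G \o F) (g' \o f')
            seqX projX extX _ _ gf1) => x.
    exact: etrans (qG _) (congr1 g (qF x)).
  exact: etrans (ig' _) (congr1 G (if' x)).
apply: (@stable_id_of_syzygy _ _ _ _ _ _ (f \o g) (F \o G) (f' \o g')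
          seqY projY extY _ _ fg1) => x.
    exact: etrans (qF _) (congr1 f (qG x)).
  exact: etrans (if' _) (congr1 F (ig' x)).
Qed.

End StableCategory.

(** * Vanishing of the first extension group *)

Section ExtVanishing.

Variable R : pzRingType.

Implicit Types A B E L M N P Q W X Y Z : lmodType R.

(** Ext^1(Y, Q) = 0 in terms of all extensions of Y, so that no projective
    presentation has to be chosen. *)
Definition ext1_zero Y Q : Prop :=
  forall A E (j : {linear A -> E}) (q : {linear E -> Y}),
    short_exact j q -> extends_along j Q.

(** Pull the extension of X back along g : Y -> X and extend u there, say to v.
    If g f = 1 + b a with b lifted to b' : P -> E, the map
    e |-> (e + b' a q e, f q e) goes from E to the pullback W and is the
    inclusion on A, so v composed with it extends u. *)
Lemma ext1_zero_stable_retract X Y Q :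
  stable_retract X Y -> ext1_zero Y Q -> ext1_zero X Q.
Proof.
move=> [f [g /stable_eq_id[P [projP [a [b gfE]]]]]] extY A E j q seq_jq u.
have [W [i [r [p [seq_ir pb pi]]]]] := pullback_short_exact g seq_jq.
have [v vE] := extY _ _ _ _ seq_ir u.
have [_ exq surjq] := seq_jq; have [_ exr _] := seq_ir; have [_ pr0 _] := pb.
have [b' b'E] := projP _ _ q b surjq.
have qb' x : q (b' x) = b x by exact: b'E.
pose e1 : {linear E -> E} := (idfun \+ (b' \o (a \o q)) : {linear _ -> _}).
have e1E e : e1 e = e + b' (a (q e)) by [].
have qe1 e : q (e1 e) = g ((f \o q : {linear _ -> _}) e).
  by rewrite e1E linearD qb' -[RHS]/((g \o f) (q e)) gfE.
have [w wE] := pullback_lift pb qe1.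
exists (v \o w : {linear _ -> _}) => x /=; rewrite -vE; congr (v _).
have qj0 : q (j x) = 0 by apply/exq; exists x.
have ri0 : r (i x) = 0 by apply/exr; exists x.
have [pw rw] := wE (j x); apply/eqP; rewrite -subr_eq0; apply/eqP.
apply: pr0; first by rewrite linearB pw pi e1E qj0 !linear0 addr0 subrr.
by rewrite linearB rw ri0 /= qj0 linear0 subr0.
Qed.

(** One projective presentation is enough: any extension E of Y is a quotient of
    A * P, and a map out of E may be defined on A and on P separately once the
    two agree over L. *)
Lemma ext1_zero_presentation L P Y Q (i : {linear L -> P}) (q : {linear P -> Y}) :
  short_exact i q -> projective P -> extends_along i Q -> ext1_zero Y Q.
Proof.
move=> [inji exq surjq] projP ext_i A E j p [injj exp surjp] u.
have [t tE] := projP _ _ p q surjp.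
have pt x : p (t x) = q x by exact: tE.
have im_ti x : exists y, j y = (t \o i : {linear _ -> _}) x.
  by apply/exp; rewrite /= pt; apply/exq; exists x.
have [m mE] := factor_inj injj im_ti.
have [F FE] := ext_i (u \o m : {linear _ -> _}).
pose s := copair j t; pose v := copair u F.
have sE x y : s (x, y) = j x + t y by [].
have vE x y : v (x, y) = u x + F y by [].
clearbody s v.
have surjs : surj s.
  move=> e; have [y qy] := surjq (p e).
  have /exp [x xE] : p (e - t y) = 0 by rewrite linearB pt qy subrr.
  by exists (x, y); rewrite sE xE subrK.
have ker_sv z : s z = 0 -> v z = 0.
  case: z => x y; rewrite sE vE => xy0.
  have jx0 : p (j x) = 0 by apply/exp; exists x.
  have /exq [l lE] : q y = 0.
    by have := congr1 p xy0; rewrite linearD jx0 pt add0r linear0.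
  rewrite -lE FE /= -linearD; suff -> : x + m l = 0 by rewrite linear0.
  by apply: injj; rewrite linearD mE /= lE xy0 linear0.
have [w wE] := factor_surj surjs ker_sv.
exists w => x; have := wE (x, 0).
by rewrite sE vE !linear0 !addr0.
Qed.

Lemma projective_prod P P' :
  projective P -> projective P' -> projective (P * P')%type.
Proof.
move=> projP projP' M N g f surjg.
have [h hE] := projP _ _ g (f \o inj_fst P P' : {linear _ -> _}) surjg.
have [k kE] := projP' _ _ g (f \o inj_snd P P' : {linear _ -> _}) surjg.
exists (copair h k) => -[x y]; rewrite /= linearD /=.
have -> : g (h x) = f (x, 0) := hE x.
have -> : g (k y) = f (0, y) := kE y.
by rewrite -linearD; congr (f (_, _)); rewrite ?addr0 ?add0r.
Qed.

(** The map PK * PM -> G is k qK on the first factor and a lift of qM through m on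
    the second.  The last conclusion makes PK a target for maps out of L that
    restrict to iK on K', which is what [ext1_zero_cokernel] needs. *)
Lemma horseshoe (K G M K' PK M' PM : lmodType R)
    (k : {linear K -> G}) (m : {linear G -> M})
    (iK : {linear K' -> PK}) (qK : {linear PK -> K})
    (iM : {linear M' -> PM}) (qM : {linear PM -> M}) :
  short_exact k m -> short_exact iK qK -> short_exact iM qM -> projective PM ->
  exists (L : lmodType R) (i : {linear L -> (PK * PM)%type})
         (q : {linear (PK * PM)%type -> G})
         (l : {linear K' -> L}) (s : {linear L -> M'}),
    [/\ short_exact i q, short_exact l s & forall x, i (l x) = (iK x, 0)].
Proof.
move=> [injk exm surjm] [injiK exqK surjqK] [injiM exqM surjqM] projPM.
have [t tE] := projPM _ _ m qM surjm.
have mt x : m (t x) = qM x by exact: tE.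
have mk x : m (k x) = 0 by apply/exm; exists x.
pose q := copair (k \o qK : {linear _ -> _}) t.
have qE x y : q (x, y) = k (qK x) + t y by [].
clearbody q.
have surjq : surj q.
  move=> g; have [y yE] := surjqM (m g).
  have /exm [x xE] : m (g - t y) = 0 by rewrite linearB mt yE subrr.
  by have [z zE] := surjqK x; exists (z, y); rewrite qE zE xE subrK.
have := kernel_short_exact surjq.
set L : lmodType R := kernel q; move: (kernel_incl q) => i seq_iq.
have [inji exq _] := seq_iq.
have qi z : q (i z) = 0 by apply/exq; exists z.
pose l0 : {linear K' -> (PK * PM)%type} := (inj_fst PK PM \o iK : {linear _ -> _}).
have l0E x : l0 x = (iK x, 0) by [].
have im_l x : exists y, i y = l0 x.
  apply/exq; rewrite l0E qE linear0 addr0.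
  have -> : qK (iK x) = 0 by apply/exqK; exists x.
  by rewrite linear0.
have [l lE] := factor_inj inji im_l.
have il x : i (l x) = (iK x, 0) by exact: lE.
have im_s z : exists y, iM y = (snd \o i : {linear _ -> _}) z.
  apply/exqM => /=; rewrite -mt; have := congr1 m (qi z).
  by case: (i z) => x y /=; rewrite qE linearD mk add0r linear0.
have [s sE] := factor_inj injiM im_s.
have iMs z : iM (s z) = (i z).2 by exact: sE.
exists L, i, q, l, s; split=> //; split=> [x y lxy|z|y].
- by apply: injiK; have := congr1 (fst \o i) lxy; rewrite /= !il.
- split=> [sz0|[x <-]]; last by apply: injiM; rewrite iMs il linear0.
  have := qi z; have := iMs z; rewrite sz0 linear0.
  case iz: (i z) => [x y] /= y0; rewrite -{}y0 in iz *.
  rewrite qE linear0 addr0 => kx0.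
  have /exqK [x' x'E] : qK x = 0 by apply: injk; rewrite kx0 linear0.
  by exists x'; apply: inji; rewrite il iz x'E.
- have /exm [x xE] : m (t (iM y)) = 0 by rewrite mt; apply/exqM; exists y.
  have [z zE] := surjqK x.
  have /exq [w wE] : q (- z, iM y) = 0 by rewrite qE !linearN zE xE addNr.
  by exists w; apply: injiM; rewrite iMs wE.
Qed.

(** An extension E of M' pulls back to an extension W of L, over which u extends to
    some v.  The restriction of v to the kernel K' of W -> E extends to PK, by
    Ext^1(K, Q) = 0; composed with W -> L and the first coordinate of i, this
    extension can be subtracted from v.  The difference is zero on
    K', so it descends to E, and it still agrees with u on A. *)
Lemma ext1_zero_cokernel (K' PK K L M' P Q : lmodType R)
    (iK : {linear K' -> PK}) (qK : {linear PK -> K})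
    (i : {linear L -> (PK * P)%type}) (l : {linear K' -> L}) (s : {linear L -> M'}) :
  short_exact iK qK -> short_exact l s -> (forall x, i (l x) = (iK x, 0)) ->
  ext1_zero K Q -> ext1_zero L Q -> ext1_zero M' Q.
Proof.
move=> seqK [injl exs surjs] il extK extL A E j q seq_jq u.
have [W [i' [r [p [seq_ir pb pi]]]]] := pullback_short_exact s seq_jq.
have [qp pr0 pbE] := pb; have [_ exr _] := seq_ir.
have [v vE] := extL _ _ _ _ seq_ir u.
have sl x : s (l x) = 0 by apply/exs; exists x.
have q0l x : q ((\0 : {linear K' -> E}) x) = s (l x) by rewrite sl linear0.
have [t tE] := pullback_lift pb q0l.
have [H HE] := extK _ _ _ _ seqK (v \o t : {linear _ -> _}).
pose D : {linear W -> Q} := (v \- (H \o (fst \o (i \o r))) : {linear _ -> _}).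
have DE w : D w = v w - H (i (r w)).1 by [].
clearbody D.
have surjp : surj p.
  move=> e; have [z zE] := surjs (q e).
  by have [w [pw _]] := pbE _ _ (esym zE); exists w.
have ker_pD w : p w = 0 -> D w = 0.
  move=> pw0; have /exs [x xE] : s (r w) = 0 by rewrite -qp pw0 linear0.
  have [pt rt] := tE x.
  have -> : w = t x.
    apply/eqP; rewrite -subr_eq0; apply/eqP.
    by apply: pr0; rewrite linearB ?pt ?rt ?pw0 ?subr0 // xE subrr.
  by rewrite DE rt il HE /= subrr.
have [w wE] := factor_surj surjp ker_pD.
exists w => x; rewrite -pi wE DE vE.
have -> : r (i' x) = 0 by apply/exr; exists x.
by rewrite linear0 /= linear0 subr0.
Qed.

End ExtVanishing.

(** * Gorenstein projective modules and higher extensions *)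

Section GorensteinProjective.

Variable R : pzRingType.

Variable perfectR : left_perfect R.

Implicit Types A B E G K L M N P Q W X Y Z : lmodType R.

Local Notation Omega := (Omega perfectR).
Local Notation syzygy := (syzygy perfectR).

(** Ext^(n+1)(Y, Q) = 0, by dimension shifting. *)
Definition ext_zero n Y Q : Prop := ext1_zero (syzygy n Y) Q.

Lemma syzygySr n X : syzygy n.+1 X = syzygy n (Omega X).
Proof. by rewrite -addn1 syzygyD. Qed.

Lemma ext_zero_stable_retract n X Y Q :
  stable_retract X Y -> ext_zero n Y Q -> ext_zero n X Q.
Proof.
by move=> retXY; apply/ext1_zero_stable_retract/stable_retract_syzygy.
Qed.

Lemma stable_retract_refl X : stable_retract X X.
Proof. exact/stable_iso_retract/(iso_stable_iso perfectR)/iso_refl. Qed.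

Lemma ext_zero_iso n X Y Q : iso X Y -> ext_zero n Y Q -> ext_zero n X Q.
Proof.
move=> isoXY; apply: ext_zero_stable_retract.
exact/stable_iso_retract/(iso_stable_iso perfectR).
Qed.

(** Any kernel of an epimorphism from a projective module computes the same higher
    Ext vanishing as the chosen syzygy; this weak form of Schanuel's lemma is the
    case X = Y of [syzygy_stable_retract]. *)
Lemma stable_retract_Omega L P Y (i : {linear L -> P}) (q : {linear P -> Y}) :
  short_exact i q -> projective P ->
  stable_retract L (Omega Y) /\ stable_retract (Omega Y) L.
Proof.
move=> seq_iq projP.
have seqY := Omega_short_exact perfectR Y.
have projY := @cover_projective _ perfectR Y.
have retY := stable_retract_refl Y.
split; first exact: syzygy_stable_retract seq_iq projP seqY projY retY.
exact: syzygy_stable_retract seqY projY seq_iq projP retY.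
Qed.

(** The piece Ext^(n+1)(K, Q) -> Ext^(n+2)(M, Q) -> Ext^(n+2)(G, Q) of the long
    exact sequence.  The induction replaces K -> G -> M by the sequence of
    syzygies given by the horseshoe lemma. *)
Lemma ext_zero_cokernel n K G M Q (k : {linear K -> G}) (m : {linear G -> M}) :
  short_exact k m -> ext_zero n K Q -> (forall i, ext_zero i.+1 G Q) ->
  ext_zero n.+1 M Q.
Proof.
elim: n K G M k m => [|n IHn] K G M k m seq_km extK extG;
  have seqK := Omega_short_exact perfectR K;
  have seqM := Omega_short_exact perfectR M;
  have projK := @cover_projective _ perfectR K;
  have projM := @cover_projective _ perfectR M;
  have [L [i [q [l [s [seq_iq seq_ls il]]]]]] := horseshoe seq_km seqK seqM projM;
  have [retL _] := stable_retract_Omega seq_iq (projective_prod projK projM).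
  apply: (ext1_zero_cokernel seqK seq_ls il extK).
  exact: ext1_zero_stable_retract retL (extG 0%N).
rewrite /ext_zero syzygySr; apply: (IHn _ _ _ _ _ seq_ls).
  by rewrite /ext_zero -syzygySr.
move=> j; apply: (ext_zero_stable_retract retL).
by rewrite /ext_zero -syzygySr; apply: extG.
Qed.

(** The hypothesis on c makes Y the cokernel of d i.  Exactness of Hom(T, Q) says
    that maps ker c -> Q extend to T i, and ker c is the cokernel of the next
    differential, so the argument repeats. *)
Lemma totally_acyclic_ext_zero (T : int -> lmodType R)
    (d : forall i, {linear T (i + 1) -> T i}) Q :
  totally_acyclic d -> projective Q ->
  forall n i Y (c : {linear T i -> Y}), surj c -> is_exact (d i) c ->
  ext_zero n Y Q.
Proof.
move=> [projT exT homT] projQ.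
have step i Y (c : {linear T i -> Y}) : surj c -> is_exact (d i) c ->
    extends_along (kernel_incl c) Q /\
    exists c' : {linear T (i + 1) -> kernel c},
      surj c' /\ is_exact (d (i + 1)) c'.
  move=> surjc exc; have [injk exk _] := kernel_short_exact surjc.
  have im_d x : exists y, kernel_incl c y = d i x.
    by apply/exk/exc; exists x.
  have [c' c'E] := factor_inj injk im_d.
  have surjc' : surj c'.
    move=> y; have /exc [x xE] : c (kernel_incl c y) = 0 by apply/exk; exists y.
    by exists x; apply: injk; rewrite c'E.
  have exc' : is_exact (d (i + 1)) c'.
    move=> y; rewrite -exT -c'E; split=> [->|k0]; first by rewrite linear0.
    by apply: injk; rewrite k0 linear0.
  split; last by exists c'.
  move=> u; have [|v vE] := (homT Q projQ i (u \o c' : {linear _ -> _})).1.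
    move=> x /=; have -> : c' (d (i + 1) x) = 0 by apply/exc'; exists x.
    by rewrite linear0.
  exists v => y; have [x <-] := surjc' y.
  by rewrite c'E -[RHS]/((u \o c') x) vE.
elim=> [|n IHn] i Y c surjc exc;
  have [ext_c [c' [surjc' exc']]] := step _ _ _ surjc exc.
  exact: ext1_zero_presentation (kernel_short_exact surjc) (projT i) ext_c.
have [_ retO] := stable_retract_Omega (kernel_short_exact surjc) (projT i).
rewrite /ext_zero syzygySr; apply: (ext_zero_stable_retract retO).
exact: IHn surjc' exc'.
Qed.

(** Split off G 0 and shift: ker e has a resolution shorter by one. *)
Lemma gproj_resolution_ext_zero r M Q :
  has_gproj_resolution M r -> projective Q ->
  forall n, (r <= n)%N -> ext_zero n M Q.
Proof.
move=> resM projQ.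
have extG G : gorenstein_projective G -> forall n, ext_zero n G Q.
  move=> [T [d [taT [c [surjc exc]]]]] n.
  exact: totally_acyclic_ext_zero taT projQ n _ _ _ surjc exc.
elim: r M resM => [|r IHr] M [G [d [e [gpG zeroG surje exe exd]]]] n.
  move=> _; apply: ext_zero_iso (extG (G 0%N) (gpG _ _) n) => //.
  apply: iso_sym; exists e; apply: injective_surj_bijective => //.
  apply: injective_ker0 => x /exe[y <-].
  by rewrite (zeroG 1%N isT y) linear0.
case: n => // n; rewrite ltnS => le_rn.
have seq_e := kernel_short_exact surje; have [injk exk _] := seq_e.
have im_d x : exists y, kernel_incl e y = d 0%N x.
  by apply/exk/exe; exists x.
have [e' e'E] := factor_inj injk im_d.
apply: (ext_zero_cokernel seq_e); last by move=> i; apply/extG/gpG.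
apply: IHr => //.
exists (fun i => G i.+1), (fun i => d i.+1), e'; split=> //.
- by move=> i le_ir; apply: gpG.
- by move=> i lt_ri; apply: zeroG.
- move=> y; have /exe [x xE] : e (kernel_incl e y) = 0 by apply/exk; exists y.
  by exists x; apply: injk; rewrite e'E.
- move=> y; rewrite -exd -e'E; split=> [->|k0]; first by rewrite linear0.
  by apply: injk; rewrite k0 linear0.
Qed.

(** Splice the sequences Y (i + 1) -> T i -> Y i.  A map u on T (i + 1) that kills
    the boundaries factors through Y (i + 1), and extends to T i exactly because
    Ext^1(Y i, Q) = 0. *)
Lemma spliced_gorenstein_projective (Y : int -> lmodType R) :
  (forall i, exists P (j : {linear Y (i + 1) -> P}) (q : {linear P -> Y i}),
     projective P /\ short_exact j q) ->
  (forall i Q, projective Q -> ext1_zero (Y i) Q) ->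
  gorenstein_projective (Y 0).
Proof.
move=> seqY extY.
have [T [j [q Tjq]]] : exists (T : int -> lmodType R)
    (j : forall i, {linear Y (i + 1) -> T i}) (q : forall i, {linear T i -> Y i}),
    forall i, projective (T i) /\ short_exact (j i) (q i).
  exists (fun i => sval (cid (seqY i))),
         (fun i => sval (cid (svalP (cid (seqY i))))),
         (fun i => sval (cid (svalP (cid (svalP (cid (seqY i))))))) => i.
  exact: svalP (cid (svalP (cid (svalP (cid (seqY i)))))).
have injj i : injective (j i) by have [_ []] := Tjq i.
have exj i : is_exact (j i) (q i) by have [_ []] := Tjq i.
have surjq i : surj (q i) by have [_ []] := Tjq i.
pose d i : {linear T (i + 1) -> T i} := (j i \o q (i + 1) : {linear _ -> _}).
have dE i x : d i x = j i (q (i + 1) x) by [].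
clearbody d.
have exd i : is_exact (d i) (q i).
  move=> y; rewrite exj; split=> -[x <-].
    by have [z <-] := surjq _ x; exists z; rewrite dE.
  by exists (q (i + 1) x); rewrite dE.
exists T, d; split; last by exists (q 0).
split=> [i|i y|Q projQ i u]; first by have [] := Tjq i.
- rewrite -exd dE; split=> [jq0|->]; last by rewrite linear0.
  by apply: injj; rewrite jq0 linear0.
- split=> [ud0|[v vE] x]; last first.
    rewrite vE /= 2!dE; have -> : q (i + 1) (j (i + 1) (q (i + 1 + 1) x)) = 0.
      by apply/exj; exists (q (i + 1 + 1) x).
    by rewrite !linear0.
  have ker_u x : q (i + 1) x = 0 -> u x = 0 by case/exd=> y <-; apply: ud0.
  have [w wE] := factor_surj (surjq _) ker_u.
  have [_ seq_jq] := Tjq i.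
  have [v vE] := extY i Q projQ _ _ _ _ seq_jq w.
  by exists v => x; rewrite /= dE vE wE.
Qed.

Lemma syzygy_period_mul k p X :
  iso (syzygy p X) X -> iso (syzygy (k * p) X) X.
Proof.
move=> isoX; elim: k => [|k IHk]; first exact: iso_refl.
rewrite mulSn addnC syzygyD.
exact: iso_trans (iso_syzygy perfectR _ isoX) IHk.
Qed.

(** Replace X by its isomorphic syzygy of order r * p, which shifts every degree
    past r. *)
Lemma periodic_ext_zero r X Q :
  periodic perfectR X -> (forall n, (r <= n)%N -> ext_zero n X Q) ->
  forall n, ext_zero n X Q.
Proof.
move=> [p [p_gt0 isoX]] extX n.
apply: ext_zero_iso (iso_sym (syzygy_period_mul r isoX)) _.
rewrite /ext_zero -syzygyD; apply: extX.
by rewrite (leq_trans (leq_pmulr r p_gt0)) ?leq_addl.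
Qed.

(** In degree -(n + 1) of the spliced complex stands the syzygy of order
    (n + 1) * (period - 1): it is congruent to -(n + 1) modulo the period, which
    avoids remainders. *)
Lemma periodic_gorenstein_projective X :
  periodic perfectR X -> (forall n Q, projective Q -> ext_zero n X Q) ->
  gorenstein_projective X.
Proof.
move=> [[|p] [// _ isoX]] extX.
pose Y (i : int) : lmodType R :=
  match i with Posz n => syzygy n X | Negz n => syzygy (n.+1 * p) X end.
have isoY i : iso (Y (i + 1)) (Omega (Y i)).
  case: i => [n|[|n]].
  - have -> : Posz n + 1 = Posz n.+1 by rewrite -addn1.
    exact: iso_refl.
  - have -> : Negz 0 + 1 = 0 :> int by [].
    by rewrite /= mul1n; apply: iso_sym.
  - have -> : Negz n.+1 + 1 = Negz n.
      by rewrite !NegzE -[n.+2]addn1 PoszD opprD addrNK.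
    rewrite /= -[Omega _]/(syzygy (n.+2 * p).+1 X).
    have -> : (n.+2 * p).+1 = (n.+1 * p + p.+1)%N by rewrite mulSn addnC addnS.
    by rewrite syzygyD; apply/iso_syzygy/iso_sym.
apply: (@spliced_gorenstein_projective Y) => [i|[n|n] Q projQ]; last 2 first.
- exact: extX.
- exact: extX.
have [f bijf] := isoY i.
have [inji exi surji] := Omega_short_exact perfectR (Y i).
exists (cover_obj perfectR (Y i)), (Omega_incl perfectR (Y i) \o f : {linear _ -> _}).
exists (cover_map perfectR (Y i)); split; first exact: cover_projective.
split=> [||//]; first by apply: inj_comp => //; apply: bij_inj.
move=> y; rewrite exi; split=> -[x <-]; last by exists (f x).
by have [g _ gK] := bijf; exists (g x); rewrite /= gK.
Qed.

(** The endomorphism d (x, y) = (y, 0) of P * P has kernel equal to its image and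
    cokernel P.  The complex with the constant term P * P and this differential
    replaces 0 -> P -> P -> 0, whose terms depend on the degree. *)
Lemma projective_gorenstein_projective P :
  projective P -> gorenstein_projective P.
Proof.
move=> projP.
pose d : {linear (P * P)%type -> (P * P)%type} := (inj_fst P P \o snd : {linear _ -> _}).
have dE x y : d (x, y) = (y, 0) by [].
clearbody d.
exists (fun=> (P * P)%type), (fun=> d); split; last first.
  exists (snd : {linear _ -> _}); split=> [y|[x y]]; first by exists (0, y).
  by split=> /= [->|[[x' y']]]; [exists (0, x); rewrite dE | rewrite dE => -[_ <-]].
split=> [_|_ [x y]|Q projQ _ u]; first exact: projective_prod.
  rewrite dE; split=> [[->]|[[x' y']]]; first by exists (0, x); rewrite dE.
  by rewrite dE => -[_ <-].
split=> [ud0|[v vE] [x y]]; last by rewrite vE /= !dE linear0.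
exists (u \o (inj_snd P P \o fst) : {linear _ -> _}) => -[x y].
rewrite /= dE; have -> : (x, y) = d (0, x) + (0, y).
  by rewrite dE; congr pair; rewrite /= ?addr0 ?add0r.
by rewrite linearD ud0 add0r.
Qed.

(** The covers P_(n-1), ..., P_0 of the successive syzygies complete Omega^n M to a
    resolution of length n. *)
Lemma gproj_resolution_of_syzygy n M :
  gorenstein_projective (syzygy n M) -> has_gproj_resolution M n.
Proof.
elim: n M => [|n IHn] M.
  move=> gpM; pose O : lmodType R := kernel (idfun : {linear M -> M}).
  have O0 (x : O) : x = 0.
    by apply: val_inj; have := valP x; rewrite inE => /eqP.
  pose G (i : nat) : lmodType R := if i is 0%N then M else O.
  exists G, (fun i => \0 : {linear G i.+1 -> G i}), (idfun : {linear _ -> _}).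
  split=> //.
  - by case.
  - by case=> // i _ x; apply: O0.
  - by move=> y; exists y.
  - by move=> y; split=> [/= ->|[x <-]]; [exists 0 | ].
  - by move=> i y; split=> // _; exists 0; rewrite (O0 y).
rewrite syzygySr => /IHn[G [d [e [gpG zeroG surje exe exd]]]].
have [inji exi surji] := Omega_short_exact perfectR M.
pose G' (i : nat) : lmodType R := if i is i'.+1 then G i' else cover_obj perfectR M.
pose d' (i : nat) : {linear G' i.+1 -> G' i} :=
  match i return {linear G' i.+1 -> G' i} with
  | i'.+1 => d i'
  | 0%N => (Omega_incl perfectR M \o e : {linear _ -> _})
  end.
exists G', d', (cover_map perfectR M); split=> //.
- case=> [_|i le_in]; last exact: gpG.
  exact/projective_gorenstein_projective/cover_projective.
- by case=> // i lt_ni; apply: zeroG.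
- move=> y; rewrite exi; split=> -[x <-]; last by exists (e x).
  by have [z <-] := surje x; exists z.
- case=> [y|i]; last exact: exd.
  rewrite -exe; split=> [i0|ey0]; last first.
    exact: etrans (congr1 (Omega_incl perfectR M) ey0) (linear0 _).
  by apply: inji; rewrite linear0.
Qed.

End GorensteinProjective.

(** * The periodic dimension *)

Lemma nat_inf_some (P : nat -> Prop) n :
  nat_inf P = Some n <-> P n /\ forall m, P m -> (n <= m)%N.
Proof.
rewrite /nat_inf; case: pselect => [exP|noP]; last first.
  by split=> // -[Pn _]; case: noP; exists n; apply/asboolP.
case: ex_minnP => k /asboolP Pk min_k; split=> [[<-]|[Pn min_n]].
  by split=> // m Pm; apply/min_k/asboolP.
by congr Some; apply/eqP; rewrite eqn_leq min_n // min_k //; apply/asboolP.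
Qed.

Lemma nat_inf_ex (P : nat -> Prop) : (exists n, P n) -> exists n, nat_inf P = Some n.
Proof.
rewrite /nat_inf => -[n Pn]; case: pselect => [exP|[]]; first by exists (ex_minn exP).
by exists n; apply/asboolP.
Qed.

Local Close Scope ring_scope.

Theorem theorem3p8 (R : pzRingType) (perfectR : left_perfect R)
    (M : lmodType R) (r : nat) :
  eventually_periodic perfectR M ->
  Gpd M = Some r ->
  exists n p : nat,
    [/\ per_dim perfectR M = Some n,
        (r <= n <= r + 1)%N,
        period perfectR (syzygy perfectR n M) = Some p &
        stable_iso (syzygy perfectR (r + p) M) (syzygy perfectR r M)].
Proof.
move=> /nat_inf_ex[n per_n] /nat_inf_some[resM minr].
have [periodic_n min_n] := (nat_inf_some _ _).1 per_n.
have [p per_p] := nat_inf_ex periodic_n.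
have [[p_gt0 iso_p] _] := (nat_inf_some _ _).1 per_p.
have extM Q m : projective Q -> (r <= m)%N -> ext_zero perfectR m M Q.
  by move=> projQ; apply: gproj_resolution_ext_zero.
have le_rn : (r <= n)%N.
  apply/minr/(gproj_resolution_of_syzygy (perfectR := perfectR)).
  apply: (periodic_gorenstein_projective periodic_n) => m Q projQ.
  apply: (periodic_ext_zero (r := r) periodic_n) => k le_rk.
  rewrite /ext_zero -syzygyD; apply: extM => //.
  by rewrite (leq_trans le_rk) ?leq_addr.
have ext_Omega m Q : (r <= m)%N -> projective Q ->
    extends_along (Omega_incl perfectR (syzygy perfectR m M)) Q.
  by move=> le_rm projQ; apply: extM projQ le_rm _ _ _ _ (Omega_short_exact _ _).
have stable_r : stable_iso (syzygy perfectR (r + p) M) (syzygy perfectR r M).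
  have: stable_iso (syzygy perfectR (r + (n - r) + p) M)
                   (syzygy perfectR (r + (n - r)) M).
    rewrite subnKC // addnC syzygyD; exact: iso_stable_iso.
  elim: (n - r)%N => [|k IHk]; first by rewrite addn0.
  rewrite addnS addSn => stable_k; apply: IHk.
  have le_k : r <= r + k by rewrite leq_addr.
  have le_kp : r <= r + k + p by rewrite (leq_trans le_k) ?leq_addr.
  apply: stable_iso_of_Omega stable_k => Q projQ.
    exact: ext_Omega le_kp projQ.
  exact: ext_Omega le_k projQ.
exists n, p; split=> //; rewrite le_rn min_n //.
exists p; split=> //; rewrite -syzygyD addnC addn1 addSn.
exact: stable_iso_Omega stable_r.
Qed.
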